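(* Let $\Lambda$ be a finite dimensional algebra over a field, let $0\to A\to B\to C\to0$ be a short exact sequence in $\mathrm{mod}\,\Lambda$, let $k>1$ be an integer and $n$ a nonnegative integer. If $k\text{-}\operatorname{dell}A\le n-1$ and $(k-1)\text{-}\operatorname{dell}B\le n$, then $(k-1)\text{-}\operatorname{edell}C\le n$.
   Context: $\mathrm{mod}\,\Lambda$ is the category of finitely generated right $\Lambda$-modules. $\mathbb N$ is the set of nonnegative integers; the infimum of the empty set is $+\infty$. $\Omega M$ is the kernel of a projective cover of $M$, $\Omega^0M=M$, $\Omega^{n+1}M=\Omega(\Omega^nM)$. ''$U$ is a direct summand of $V$ up to projective summands'' means that $U$ is isomorphic to a direct summand of $V\oplus P$ for some projective $P$. For an integer $k\ge1$: $k\text{-}\operatorname{dell}M$ is the infimum of all $n\in\mathbb N$ such that $\Omega^nM$ is a direct summand of $\Omega^{n+k}N$ up to projective summands for some $N\in\mathrm{mod}\,\Lambda$; and $k\text{-}\operatorname{edell}M$ is the infimum of all $n\in\mathbb N$ such that for every integer $k'\ge1$ and every right $\Lambda$-module $X$ of injective dimension $\mathrm{id}\,X=n+k-1+k'$ one has $\mathrm{Ext}_\Lambda^{n+k'}(M,X)=0$. *)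

(* Defs.v *)
From HB Require Import structures.
From mathcomp Require Import all_boot all_order all_algebra all_field.
From mathcomp Require Import boolp constructive_ereal.
From mathcomp Require multinomials.freeg.

Set Implicit Arguments.
Unset Strict Implicit.
Unset Printing Implicit Defensive.

Import Order.TTheory GRing.Theory Num.Theory.
Local Open Scope ring_scope.

(* Infimum of a set of nonnegative integers, in the integers extended with
   infinities, so that it can be compared with the possibly negative n - 1. *)
Definition inf_nat (S : nat -> Prop) : \bar int :=
  if pselect (exists n, `[< S n >]) is left ex then ((ex_minn ex)%:Z)%:E
  else +oo%E.

Lemma inf_nat_le (S : nat -> Prop) (m : int) :
  (inf_nat S <= m%:E)%E <-> exists2 n : nat, S n & n%:Z <= m.
Proof.
rewrite /inf_nat; case: pselect => [ex|nex].
  rewrite lee_fin; case: ex_minnP => n /asboolP Sn minn; split; first by exists n.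
  by case=> p /asboolP/minn; rewrite -lez_nat; apply: le_trans.
by split=> // -[n Sn _]; case: nex; exists n; apply/asboolP.
Qed.

Lemma inf_nat_eq (S : nat -> Prop) (m : nat) :
  inf_nat S = (m%:Z)%:E <-> S m /\ forall n, S n -> (m <= n)%N.
Proof.
rewrite /inf_nat; case: pselect => [ex|nex]; last first.
  by split=> // -[Sm _]; case: nex; exists m; apply/asboolP.
case: ex_minnP => n /asboolP Sn minn; split.
  by case=> <-; split=> // p /asboolP/minn.
case=> Sm minm; congr (_%:Z%:E); apply/eqP.
by rewrite eqn_leq minm // minn //; apply/asboolP.
Qed.

(* Left modules over an arbitrary ring R. Right modules over L are left modules
   over the converse ring L^c. *)
Section Modules.
Variable R : nzRingType.
Implicit Types M N P Q X U V W K : lmodType R.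

Definition finitely_generated M : Prop :=
  exists s : seq M, forall x : M,
    exists c : 'I_(size s) -> R, x = \sum_(i < size s) c i *: s`_i.

Definition surjective M N (f : M -> N) : Prop := forall y, exists x, f x = y.

Definition exact_at M N P (f : M -> N) (g : N -> P) : Prop :=
  forall y : N, g y = 0 <-> exists x : M, f x = y.

Definition short_exact M N P (f : {linear M -> N}) (g : {linear N -> P}) : Prop :=
  [/\ injective f, exact_at f g & surjective g].

Definition isomorphic M N : Prop := exists f : {linear M -> N}, bijective f.

Definition zero_module M : Prop := forall x : M, x = 0.

Definition projective P : Prop :=
  forall M N (g : {linear M -> N}) (f : {linear P -> N}), surjective g ->
    exists h : {linear P -> M}, forall x, g (h x) = f x.

Definition injective_module X : Prop :=
  forall M N (i : {linear M -> N}) (f : {linear M -> X}), injective i ->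
    exists h : {linear N -> X}, forall x, h (i x) = f x.

Definition essential_epi P M (p : {linear P -> M}) : Prop :=
  surjective p /\
  forall Q (g : {linear Q -> P}), surjective (fun x => p (g x)) -> surjective g.

Definition projective_cover P M (p : {linear P -> M}) : Prop :=
  projective P /\ essential_epi p.

(* Omega M is only defined up to isomorphism, hence a relation. *)
Definition is_syzygy M K : Prop :=
  exists P (p : {linear P -> M}) (i : {linear K -> P}),
    [/\ projective_cover p, injective i & exact_at i p].

Fixpoint is_nth_syzygy (n : nat) M K : Prop :=
  if n is m.+1 then exists2 K', is_nth_syzygy m M K' & is_syzygy K' K
  else isomorphic M K.

Definition direct_summand U W : Prop :=
  exists V, isomorphic (U * V)%type W.

Definition stable_summand U V : Prop :=
  exists2 P, projective P & direct_summand U (V * P)%type.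

Record proj_resolution M := ProjResolution {
  pres_obj : nat -> lmodType R;
  pres_map : forall i, {linear pres_obj i.+1 -> pres_obj i};
  pres_aug : {linear pres_obj 0 -> M};
  pres_proj : forall i, projective (pres_obj i);
  pres_aug_surj : surjective pres_aug;
  pres_exact0 : exact_at (pres_map 0) pres_aug;
  pres_exact : forall i, exact_at (pres_map i.+1) (pres_map i) }.

Record inj_resolution X := InjResolution {
  ires_obj : nat -> lmodType R;
  ires_map : forall i, {linear ires_obj i -> ires_obj i.+1};
  ires_aug : {linear X -> ires_obj 0};
  ires_inj : forall i, injective_module (ires_obj i);
  ires_aug_inj : injective ires_aug;
  ires_exact0 : exact_at ires_aug (ires_map 0);
  ires_exact : forall i, exact_at (ires_map i) (ires_map i.+1) }.

Section Cohomology.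
Variables (M X : lmodType R) (P : proj_resolution M).

Definition cocycle n (phi : {linear pres_obj P n -> X}) : Prop :=
  forall x, phi (pres_map P n x) = 0.

Definition coboundary n : {linear pres_obj P n -> X} -> Prop :=
  match n with
  | 0 => fun phi => forall x, phi x = 0
  | m.+1 => fun phi =>
      exists psi : {linear pres_obj P m -> X}, forall x, phi x = psi (pres_map P m x)
  end.

End Cohomology.

(* Ext^n(M, X) = 0, where Ext^n(M, X) is the n-th cohomology of Hom(P, X) for a
   projective resolution P of M. The group does not depend on P up to
   isomorphism; see free_resolution below for the existence of P. *)
Definition Ext_vanishes (n : nat) M X : Prop :=
  forall (P : proj_resolution M) (phi : {linear pres_obj P n -> X}),
    cocycle phi -> coboundary phi.

Definition inj_dim X : \bar int :=
  inf_nat (fun n => exists I : inj_resolution X,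
    forall i, (n < i)%N -> zero_module (ires_obj I i)).

Definition dell (k : nat) M : \bar int :=
  inf_nat (fun n => exists N U V,
    [/\ finitely_generated N, is_nth_syzygy n M U,
        is_nth_syzygy (n + k) N V & stable_summand U V]).

Definition edell (k : nat) M : \bar int :=
  inf_nat (fun n => forall (k' : nat) X, (1 <= k')%N ->
    inj_dim X = ((n + k - 1 + k')%N%:Z)%:E -> Ext_vanishes (n + k') M X).

End Modules.

Section FreeResolution.
Import freeg.
Variable R : nzRingType.
Implicit Types M N : lmodType R.

Lemma fglift_linear (K : choiceType) M (f : K -> M) : linear (fglift f : {freeg K / R} -> M).
Proof.
move=> c D1 D2; rewrite -[D1]Freeg_enum -[D2]Freeg_enum.
move: (fgenum D1) (fgenum D2) => s t.
have -> : c *: [freeg s] = [freeg [seq (c * x.1, x.2) | x <- s]] :> {freeg K / R}.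
  apply/eqP/freeg_eqP => y; rewrite coeffZ !coeff_Freeg /precoeff big_map mulr_sumr.
  exact: eq_bigr.
rewrite -freeg_cat !fglift_Freeg prelift_cat /prelift big_map scaler_sumr.
by congr (_ + _); apply: eq_bigr => x _; rewrite scalerA.
Qed.

Definition lin_of M N (f : M -> N) (lf : linear f) : {linear M -> N} :=
  let i := @GRing.isLinear.Build R M N *:%R f lf in HB.pack f i.

Definition free_on M : lmodType R := {freeg M / R}.
Definition free_aug M : {linear free_on M -> M} := lin_of (fglift_linear id).

Lemma free_aug_surj M : surjective (free_aug M).
Proof. by move=> x; exists (<< x >> : {freeg M / R}); rewrite /= liftU scale1r. Qed.

Lemma free_on_proj (M : lmodType R) : projective (free_on M).
Proof.
move=> N Q g f gs.
have [s sP] := choice (fun x : M => gs (f (<< x >> : {freeg M / R}))).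
exists (lin_of (fglift_linear s)) => D /=.
have fsum (U : lmodType R) (h : {linear free_on M -> U}) : h D =
    \sum_(z <- dom D) coeff z D *: h (<< z >> : {freeg M / R}).
  rewrite -{1}[D]freeg_sumE raddf_sum; apply: eq_bigr => z _ /=.
  rewrite -linearZ; congr (h _); apply/eqP/freeg_eqP => y.
  by rewrite coeffZ !coeffU mul1r.
rewrite (fsum _ f) -[fglift s D]/(lin_of (fglift_linear s) D) fsum linear_sum.
by apply: eq_bigr => z _; rewrite linearZ /= liftU scale1r sP.
Qed.

Section Kernel.
Variables (M N : lmodType R) (f : {linear M -> N}).
Definition ker_pred : {pred M} := fun x => f x == 0.
Lemma ker_submod : submod_closed ker_pred.
Proof.
split=> [|c x y]; rewrite /ker_pred !unfold_in ?linear0 // => /eqP fx /eqP fy.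
by rewrite linearP fx fy scaler0 addr0.
Qed.
HB.instance Definition _ := GRing.isSubmodClosed.Build R M ker_pred ker_submod.
Record ker_type := KerType { ker_val : M; _ : ker_val \in ker_pred }.
HB.instance Definition _ := [isSub for ker_val].
HB.instance Definition _ := [Choice of ker_type by <:].
HB.instance Definition _ := [SubChoice_isSubLmodule of ker_type by <:].
Definition ker_mod : lmodType R := ker_type.
Definition ker_incl : {linear ker_mod -> M} := val : ker_type -> M.
Lemma ker_incl_exact (x : M) : f x = 0 <-> exists y, ker_incl y = x.
Proof.
split=> [fx|[[y /= yk] <-]]; last exact/eqP.
have xk : x \in ker_pred by rewrite unfold_in; apply/eqP.
by exists (KerType xk).
Qed.
Lemma ker_incl_inj : injective ker_incl. Proof. exact: val_inj. Qed.
End Kernel.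

Fixpoint free_syz M (i : nat) : lmodType R :=
  if i is j.+1 then ker_mod (free_aug (free_syz M j)) else M.

Definition free_map M i : {linear free_on (free_syz M i.+1) -> free_on (free_syz M i)} :=
  (ker_incl (free_aug (free_syz M i)) \o free_aug (free_syz M i.+1)).

Lemma free_exact M i : exact_at (free_map M i) (free_aug (free_syz M i)).
Proof.
move=> y; rewrite ker_incl_exact; split=> [[z zy]|[x <-]]; last by exists (free_aug _ x).
by have [x xz] := free_aug_surj z; exists x; rewrite /= -zy -xz.
Qed.

Definition free_resolution M : proj_resolution M.
Proof.
apply: (@ProjResolution R M (fun i => free_on (free_syz M i)) (free_map M) (free_aug M)).
- by move=> i; apply: free_on_proj.
- exact: free_aug_surj.
- exact: (free_exact (i := 0)).
- move=> i y; rewrite -free_exact; split=> [ry0|ry0].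
    by apply: (@ker_incl_inj _ _ (free_aug (free_syz M i))); rewrite raddf0.
  by rewrite -[LHS]/(ker_incl (free_aug (free_syz M i)) _) ry0 raddf0.
Defined.
End FreeResolution.

(* Main.v *)
Require Import Defs.
From mathcomp Require Import all_boot all_order all_algebra all_field.
From mathcomp Require Import boolp constructive_ereal zify.
Import GRing.Theory.
Local Open Scope ring_scope.

(** In the long exact sequence
      Ext^(n+k'-1)(A,X) -> Ext^(n+k')(C,X) -> Ext^(n+k')(B,X)
    with id X = n+k-2+k', dimension shifting makes both outer groups direct
    summands of groups Ext^(n+k'+k-1)(N,X), which vanish since the degree exceeds
    id X.  All Ext groups are computed from one fixed injective resolution of X of
    minimal length, so that independence of projective resolutions is not needed;
    only the vanishing of Ext(C,X) has to be carried over to an arbitrary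
    projective resolution of C. *)

Section ExtByInjectives.
Set Implicit Arguments.
Unset Strict Implicit.
Variable R : nzRingType.
Implicit Types M N P Q K U V A B C : lmodType R.

(** * Factoring linear maps through surjections, injections and exact pairs *)

Lemma factor_surjective P M N (p : {linear P -> M}) (f : {linear P -> N}) :
    surjective p -> (forall x, p x = 0 -> f x = 0) ->
  exists w : {linear M -> N}, forall x, w (p x) = f x.
Proof.
move=> psurj fker; have [s sK] := choice psurj.
have fE x y : p x = p y -> f x = f y.
  move=> pxy; apply/eqP; rewrite -subr_eq0 -linearB; apply/eqP/fker.
  by rewrite linearB pxy subrr.
have lin_fs : linear (f \o s).
  by move=> c x y /=; rewrite -linearP; apply: fE; rewrite linearP !sK.
by exists (lin_of lin_fs) => x /=; apply: fE; rewrite sK.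
Qed.

Lemma factor_injective M K P (i : {linear K -> P}) (f : {linear M -> P}) :
    injective i -> (forall x, exists y, i y = f x) ->
  exists u : {linear M -> K}, forall x, i (u x) = f x.
Proof.
move=> iinj fim; have [u uK] := choice fim.
have lin_u : linear u by move=> c x y; apply: iinj; rewrite linearP !uK linearP.
by exists (lin_of lin_u).
Qed.

(** Both [f] and [h] corestrict to the kernel of [g], onto which [f] is surjective by exactness;
    projectivity then lifts [h]. *)
Lemma projective_factor_exact P M N Q (f : {linear M -> N}) (g : {linear N -> Q})
    (h : {linear P -> N}) :
    projective P -> exact_at f g -> (forall x, g (h x) = 0) ->
  exists e : {linear P -> M}, forall x, f (e x) = h x.
Proof.
move=> projP fg_exact gh0.
have [h' h'E] : exists h' : {linear P -> ker_mod g}, forall x, ker_incl g (h' x) = h x.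
  apply: factor_injective; first exact: ker_incl_inj.
  by move=> x; apply/ker_incl_exact/gh0.
have [f' f'E] : exists f' : {linear M -> ker_mod g}, forall x, ker_incl g (f' x) = f x.
  apply: factor_injective; first exact: ker_incl_inj.
  by move=> x; apply/ker_incl_exact/fg_exact; exists x.
have [|e eE] := projP _ _ f' h'.
  move=> y; have /fg_exact[x fx] : g (ker_incl g y) = 0.
    by apply/ker_incl_exact; exists y.
  by exists x; apply: (@ker_incl_inj _ _ _ g); rewrite f'E.
by exists e => x; rewrite -f'E eE h'E.
Qed.

(** * Vanishing of Ext, computed from a fixed injective resolution *)

Section FixedResolution.
Variables (X : lmodType R) (I : inj_resolution X).

Local Notation d n := (ires_map I n).

(* Vanishing of Ext^(n+1)(M, X): the degree is shifted by one. *)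
Definition inj_ext_vanishes n M : Prop :=
  forall h : {linear M -> ires_obj I n.+1}, (forall x, d n.+1 (h x) = 0) ->
    exists h' : {linear M -> ires_obj I n}, forall x, d n (h' x) = h x.

Lemma ires_mapK n x : d n.+1 (d n x) = 0.
Proof. by apply/ires_exact; exists x. Qed.

Lemma inj_ext_vanishes_projective n P : projective P -> inj_ext_vanishes n P.
Proof. move=> projP h; exact: projective_factor_exact (@ires_exact _ _ I n). Qed.

Lemma inj_ext_vanishes_zero n M : zero_module (ires_obj I n.+1) -> inj_ext_vanishes n M.
Proof.
move=> I0 h _; exists (\0 : {linear M -> ires_obj I n}) => x.
by rewrite [LHS]I0 [RHS]I0.
Qed.

Lemma inj_ext_vanishes_retract n U V (i : {linear U -> V}) (r : {linear V -> U}) :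
  cancel i r -> inj_ext_vanishes n V -> inj_ext_vanishes n U.
Proof.
move=> ir extV h dh; have [|h' h'E] := extV (h \o r : {linear V -> _}).
  by move=> x /=; apply: dh.
by exists (h' \o i : {linear U -> _}) => x /=; rewrite h'E /= ir.
Qed.

Lemma inj_ext_vanishes_isomorphic n M N :
  isomorphic M N -> inj_ext_vanishes n M <-> inj_ext_vanishes n N.
Proof.
move=> [u [v uK vK]].
have lin_v : linear v by move=> c x y; apply: (can_inj uK); rewrite linearP !vK.
by split; [apply: (@inj_ext_vanishes_retract n N M (lin_of lin_v) u)
         | apply: (@inj_ext_vanishes_retract n M N u (lin_of lin_v))].
Qed.

Lemma inj_ext_vanishes_prod n M N :
  inj_ext_vanishes n M -> inj_ext_vanishes n N -> inj_ext_vanishes n (M * N)%type.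
Proof.
move=> extM extN h dh.
have lin_l : linear (fun x : M => (x, 0) : M * N).
  by move=> c x y; congr pair; rewrite /= scaler0 addr0.
have lin_r : linear (fun y : N => (0, y) : M * N).
  by move=> c x y; congr pair; rewrite /= scaler0 addr0.
have [|u uE] := extM (h \o lin_of lin_l : {linear M -> _}).
  by move=> x; apply: dh.
have [|v vE] := extN (h \o lin_of lin_r : {linear N -> _}).
  by move=> x; apply: dh.
have lin_uv : linear (fun z : M * N => u z.1 + v z.2).
  by move=> c x y; rewrite /= !linearP /= scalerDr addrACA.
exists (lin_of lin_uv) => -[x y] /=; rewrite linearD uE vE /= -linearD.
by congr (h (_, _)); rewrite /= ?addr0 ?add0r.
Qed.

(** The extra projective summand is harmless because only Ext in positive degree is involved. *)
Lemma inj_ext_vanishes_stable_summand n U V :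
  stable_summand U V -> inj_ext_vanishes n V -> inj_ext_vanishes n U.
Proof.
move=> [P projP [W isoUW]] extV.
have lin_l : linear (fun x : U => (x, 0) : U * W).
  by move=> c x y; congr pair; rewrite /= scaler0 addr0.
have lin_fst : linear (fun z : U * W => z.1) by [].
apply: (@inj_ext_vanishes_retract n U _ (lin_of lin_l) (lin_of lin_fst)) => //.
apply/(inj_ext_vanishes_isomorphic _ isoUW)/inj_ext_vanishes_prod => //.
exact: inj_ext_vanishes_projective.
Qed.

(** * Long exact sequence and dimension shifting *)

Lemma inj_ext_vanishes_quotient n A B C (f : {linear A -> B}) (g : {linear B -> C}) :
    short_exact f g -> inj_ext_vanishes n A -> inj_ext_vanishes n.+1 B ->
  inj_ext_vanishes n.+1 C.
Proof.
move=> [finj fg gsurj] extA extB h dh.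
(* The restriction of [e] to [A] is a cocycle, hence the coboundary of some [u]. Subtracting the
   coboundary of an extension [v] of [u] to [B] makes [e] vanish on [A], so it descends to [C]. *)
have [|e eE] := extB (h \o g : {linear B -> _}); first by move=> x; apply: dh.
have [|u uE] := extA (e \o f : {linear A -> _}).
  move=> x /=; rewrite eE /=.
  have -> : g (f x) = 0 by apply/fg; exists x.
  by rewrite linear0.
have [v vE] := ires_inj (i0 := I) (i := n) u finj.
have [|w wE] := factor_surjective (p := g) (f := e \- (d n \o v) : {linear B -> _}) gsurj.
  by move=> _ /fg[x <-] /=; rewrite vE uE subrr.
exists w => y; have [x <-] := gsurj y.
by rewrite wE /= linearB eE ires_mapK subr0.
Qed.

(** The connecting map Ext^(n+1)(K,X) -> Ext^(n+2)(M,X) is injective since Ext^(n+1)(P,X) = 0; [h']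
    represents the image of the class of [h]. *)
Lemma inj_ext_vanishes_kernel n K P M (i : {linear K -> P}) (p : {linear P -> M}) :
    projective P -> short_exact i p ->
  inj_ext_vanishes n.+1 M -> inj_ext_vanishes n K.
Proof.
move=> projP [iinj ip psurj] extM h dh.
have [e eE] := ires_inj h iinj.
have [|h' h'E] := factor_surjective (p := p) (f := d n.+1 \o e : {linear P -> _}) psurj.
  by move=> _ /ip[x <-] /=; rewrite eE dh.
have [|w wE] := extM h'.
  by move=> y; have [x <-] := psurj y; rewrite h'E ires_mapK.
have [|v vE] := @inj_ext_vanishes_projective n P projP (e \- (w \o p) : {linear P -> _}).
  by move=> x; rewrite /= linearB wE h'E subrr.
exists (v \o i : {linear K -> _}) => x; rewrite /= vE /= eE.
have -> : p (i x) = 0 by apply/ip; exists x.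
by rewrite linear0 subr0.
Qed.

Lemma inj_ext_vanishes_syzygy n M K :
  is_syzygy M K -> inj_ext_vanishes n K <-> inj_ext_vanishes n.+1 M.
Proof.
move=> [P [p [i [[projP [psurj _]] iinj ip]]]].
have ses : short_exact i p by split.
split=> [extK|]; last exact: inj_ext_vanishes_kernel projP ses.
exact: inj_ext_vanishes_quotient ses extK (inj_ext_vanishes_projective projP).
Qed.

Lemma inj_ext_vanishes_nth_syzygy m n M K :
  is_nth_syzygy m M K -> inj_ext_vanishes n K <-> inj_ext_vanishes (m + n) M.
Proof.
elim: m n K => [|m IH] n K /=.
  by move=> isoMK; rewrite (inj_ext_vanishes_isomorphic _ isoMK).
by move=> [K' /IH extK' /inj_ext_vanishes_syzygy ->]; rewrite extK' addnS.
Qed.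

(** * Transfer to an arbitrary projective resolution *)

Lemma inj_ext_vanishes_kernel0 K P M (i : {linear K -> P}) (p : {linear P -> M})
    (h : {linear K -> X}) :
    short_exact i p -> inj_ext_vanishes 0 M ->
  exists psi : {linear P -> X}, forall x, psi (i x) = h x.
Proof.
move=> [iinj ip psurj] extM; pose a := ires_aug I.
have da x : d 0 (a x) = 0 by apply/ires_exact0; exists x.
have [e eE] := ires_inj (a \o h : {linear K -> _}) iinj.
have [|h' h'E] := factor_surjective (p := p) (f := d 0 \o e : {linear P -> _}) psurj.
  by move=> _ /ip[x <-] /=; rewrite eE da.
have [|w wE] := extM h'.
  by move=> y; have [x <-] := psurj y; rewrite h'E ires_mapK.
(* The correction [w \o p] vanishes on [K], so the difference still extends [a \o h]; it now takes
   values in the kernel of [d 0], which is the image of [X]. *)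
have [|psi psiE] := factor_injective (i := a) (f := e \- (w \o p) : {linear P -> _})
    (@ires_aug_inj _ _ I).
  by move=> x; apply/ires_exact0; rewrite /= linearB wE h'E subrr.
exists psi => x; apply: (@ires_aug_inj _ _ I); rewrite -/a psiE /= eE.
have -> : p (i x) = 0 by apply/ip; exists x.
by rewrite linear0 subr0.
Qed.

Definition tail_aug M (P : proj_resolution M) :
  {a : {linear pres_obj P 1 -> ker_mod (pres_aug P)} |
    forall x, ker_incl (pres_aug P) (a x) = pres_map P 0 x}.
Proof.
apply/cid/factor_injective; first exact: ker_incl_inj.
by move=> x; apply/ker_incl_exact/pres_exact0; exists x.
Qed.

Lemma tail_aug_surj M (P : proj_resolution M) : surjective (sval (tail_aug P)).
Proof.
move=> y; have /pres_exact0[x xE] : pres_aug P (ker_incl _ y) = 0.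
  by apply/ker_incl_exact; exists y.
by exists x; apply: (@ker_incl_inj _ _ _ (pres_aug P)); rewrite (svalP (tail_aug P)).
Qed.

Lemma tail_aug_exact M (P : proj_resolution M) :
  exact_at (pres_map P 1) (sval (tail_aug P)).
Proof.
move=> x; rewrite -(@pres_exact _ _ P 0 x) -(svalP (tail_aug P)).
split=> [->|ax0]; first by rewrite linear0.
by apply: (@ker_incl_inj _ _ _ (pres_aug P)); rewrite ax0 linear0.
Qed.

Definition tail_resolution M (P : proj_resolution M) :
    proj_resolution (ker_mod (pres_aug P)) :=
  @ProjResolution R (ker_mod (pres_aug P)) (fun i => pres_obj P i.+1)
    (fun i => pres_map P i.+1) (sval (tail_aug P)) (fun i => @pres_proj _ _ P i.+1)
    (@tail_aug_surj M P) (@tail_aug_exact M P) (fun i => @pres_exact _ _ P i.+1).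

(** Induction on the degree, replacing [M] by the kernel of the augmentation and dropping the first
    term of [P]. In degree 1 a cocycle amounts to a map from that kernel to [X], and it is a
    coboundary once this map extends to the first term. *)
Lemma inj_ext_vanishes_Ext n M : inj_ext_vanishes n M -> Ext_vanishes n.+1 M X.
Proof.
elim: n M => [|n IH] M extM P phi phi0;
  have ses : short_exact (ker_incl (pres_aug P)) (pres_aug P)
    by split; [exact: ker_incl_inj | exact: ker_incl_exact | exact: pres_aug_surj].
  have [|h hE] := factor_surjective (f := phi) (@tail_aug_surj M P).
    by move=> _ /tail_aug_exact[x <-]; apply: phi0.
  have [psi psiE] := inj_ext_vanishes_kernel0 h ses extM.
  by exists psi => x; rewrite -(svalP (tail_aug P)) psiE hE.
have extK := inj_ext_vanishes_kernel (@pres_proj _ _ P 0) ses extM.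
exact: (IH _ extK (tail_resolution P) phi phi0).
Qed.

(** For the witness a <= n, Ext^(m+1)(M,X) = Ext^(m-a+1)(Omega^a M,X) is a direct summand of
    Ext^(m-a+1)(Omega^(a+k) N,X) = Ext^(k+m+1)(N,X), which is zero. *)
Lemma inj_ext_vanishes_dell k n m M :
    (dell k M <= (n%:Z)%:E)%E -> (n <= m)%N ->
    zero_module (ires_obj I (k + m).+1) ->
  inj_ext_vanishes m M.
Proof.
move=> /inf_nat_le[a [N [U [V [_ syzU syzV UV]]]]]; rewrite lez_nat => an nm I0.
have -> : m = (a + (m - a))%N by lia.
apply/(inj_ext_vanishes_nth_syzygy _ syzU).
apply: inj_ext_vanishes_stable_summand UV _.
apply/(inj_ext_vanishes_nth_syzygy _ syzV)/inj_ext_vanishes_zero.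
by have -> : (a + k + (m - a) = k + m)%N by lia.
Qed.

End FixedResolution.
End ExtByInjectives.

Theorem lemma2p28 (F : fieldType) (L : falgType F) (A B C : lmodType L^c)
    (f : {linear A -> B}) (g : {linear B -> C}) (k n : nat)
    (fgA : finitely_generated A) (fgB : finitely_generated B)
    (fgC : finitely_generated C) (fg_exact : short_exact f g)
    (k_gt1 : (1 < k)%N)
    (dellA : (dell k A <= (n%:Z - 1)%:E)%E)
    (dellB : (dell (k - 1) B <= (n%:Z)%:E)%E) :
  (edell (k - 1) C <= (n%:Z)%:E)%E.
Proof.
case: n dellA dellB => [|n] dellA dellB.
  (* For [n] = 0 the bound on [A] would be -1, below every nonnegative integer. *)
  by have /inf_nat_le[] := dellA.
have {}dellA : (dell k A <= (n%:Z)%:E)%E by move: dellA; rewrite intS addrC addKr.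
(* With [n.+1] for n and [k'.+1] for k', the injective dimension of [X], and so the length of [I],
   is n+k+k'. *)
apply/inf_nat_le; exists n.+1 => // -[|k'] X // _ /inf_nat_eq[[I I0] _].
rewrite addnS; apply: (inj_ext_vanishes_Ext (I := I)).
rewrite addSn; apply: (inj_ext_vanishes_quotient fg_exact).
  (* For [A] and for [B] alike, the term of [I] that has to vanish is the one of index n+k+k'+1,
     just beyond its length. *)
  by apply: inj_ext_vanishes_dell dellA _ _; [lia | apply: I0; lia].
by apply: inj_ext_vanishes_dell dellB _ _; [lia | apply: I0; lia].
Qed.
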